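(* The homology of $\mathfrak{A}_*$ with respect to $\delta$ is identically zero.
   Context: All vector spaces are over $\mathbb{Q}$. For $q\ge 0$, $\mathfrak{A}_q$ is the $\mathbb{Q}$-vector space with basis the symbols $b_\Lambda$, where $\Lambda$ ranges over the nonempty finite sets of $q$-element subsets of $\mathbb{Z}_{>0}$ (it arises as a direct limit of relative atomic complexes of $k$-equal arrangements). $\mathfrak{A}_*=\bigoplus_{q\ge0}\mathfrak{A}_q$; $\mathfrak{A}_0$ is spanned by $b_\emptyset$, meaning $b_\Lambda$ with $\Lambda=\{\emptyset\}$. Write $\bigcap\Lambda$ for the intersection of the members of $\Lambda$ and $\hat\Lambda=\{\lambda\setminus\bigcap\Lambda : \lambda\in\Lambda\}$. The family $\Lambda$ is determined by the pair $(\bigcap\Lambda,\hat\Lambda)$, and one writes $b_\Lambda=b_{(\cap\Lambda,\hat\Lambda)}$. The differential $\delta:\mathfrak{A}_q\to\mathfrak{A}_{q-1}$ is defined by $$\delta\, b_{(\cap\Lambda,\hat\Lambda)}=\sum_{i=1}^{t}(-1)^i\, b_{(\cap\Lambda\setminus\{\ell_i\},\hat\Lambda)},\qquad \bigcap\Lambda=\{\ell_1<\dots<\ell_t\}.$$ *)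

(* Defs.v *)
From HB Require Import structures.
From mathcomp Require Import all_boot all_order all_algebra.
From mathcomp Require Import finmap boolp monalg.

Set Implicit Arguments.
Unset Strict Implicit.
Unset Printing Implicit Defensive.

Import GRing.Theory.

Local Open Scope fset_scope.
Local Open Scope ring_scope.

Definition posnat := {n : nat | (0 < n)%N}.

Definition is_family (q : nat) (L : {fset {fset posnat}}) : bool :=
  (L != fset0) && all (fun s : {fset posnat} => #|` s| == q) L.

Definition family (q : nat) := {L : {fset {fset posnat}} | is_family q L}.

Definition frakA (q : nat) := {malg rat[family q]}.
HB.instance Definition _ (q : nat) := GRing.Lmodule.on (frakA q).

Definition bvec (q : nat) (L : family q) : frakA q := << L >>.

(* The elements of the union lying in every member: this is the intersection
   of the members of L when L is nonempty, as it is in every family. *)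
Definition cap (L : {fset {fset posnat}}) : {fset posnat} :=
  [fset x in fcover L | all (fun s : {fset posnat} => x \in s) L].

Definition hat (L : {fset {fset posnat}}) : {fset {fset posnat}} :=
  [fset s `\` cap L | s in L].

Definition of_pair (C : {fset posnat}) (H : {fset {fset posnat}}) :
    {fset {fset posnat}} :=
  [fset C `|` h | h in H].

(* The basis vector of the family L with (cap L, hat L) = (C, H), and 0 if
   of_pair C H is not a nonempty set of q-element sets; bvec_pairD1 shows that
   this default is never used in delta_basis. *)
Definition bvec_pair (q : nat) (C : {fset posnat}) (H : {fset {fset posnat}}) :
    frakA q :=
  oapp (@bvec q) 0 (insub (of_pair C H)).

Definition increasing (C : {fset posnat}) : seq posnat :=
  sort (fun x y => (val x <= val y)%N) C.

(* The i such that l = l_i, where C = {l_1 < ... < l_t}. *)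
Definition position (C : {fset posnat}) (l : posnat) : nat :=
  (index l (increasing C)).+1.

(* For q = 0 the set cap L is empty and the sum is zero: delta vanishes in
   degree 0 (lemma delta0), whose nominal target is frakA 0.-1 = frakA 0. *)
Definition delta_basis (q : nat) (L : family q) : frakA q.-1 :=
  let C := cap (val L) in
  \sum_(l <- increasing C)
     (-1) ^+ position C l *: bvec_pair q.-1 (C `\ l) (hat (val L)).

Definition delta (q : nat) (x : frakA q) : frakA q.-1 :=
  \sum_(L <- msupp x) x@_L *: delta_basis L.

Lemma mem_cap (L : {fset {fset posnat}}) (x : posnat) : L != fset0 ->
  reflect (forall s, s \in L -> x \in s) (x \in cap L).
Proof.
move=> L0; rewrite !inE; apply: (iffP andP) => [[_ /allP //]|xL].
split; last exact/allP.
case/fset0Pn: L0 => s0 s0L.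
by apply/bigfcupP; exists s0; rewrite ?s0L ?xL.
Qed.

Lemma of_pairE (L : {fset {fset posnat}}) (C : {fset posnat}) :
  L != fset0 -> C `<=` cap L ->
  of_pair C (hat L) = [fset s `\` (cap L `\` C) | s in L].
Proof.
move=> L0 sCL; have capS s : s \in L ->
    C `|` (s `\` cap L) = s `\` (cap L `\` C).
  move=> sL; apply/fsetP => x; rewrite !inE.
  case xC: (x \in C) => //=.
  by have /(mem_cap _ L0)/(_ s sL) -> := fsubsetP sCL _ xC.
apply/fsetP => s; apply/imfsetP/imfsetP => [[h /imfsetP[u /= uL ->] ->]|[u uL ->]].
  by exists u; rewrite ?capS.
by exists (u `\` cap L); rewrite ?capS //; apply/imfsetP; exists u.
Qed.

Lemma bvec_pairE (q : nat) (L : family q) :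
  bvec_pair q (cap (val L)) (hat (val L)) = bvec L.
Proof.
have /andP[L0 _] := valP L.
rewrite /bvec_pair of_pairE // (_ : [fset _ | _ in _] = val L) ?valK //.
apply/fsetP => s; rewrite fsetDv; apply/imfsetP/idP => [[u uL ->]|sL].
  by rewrite fsetD0.
by exists s; rewrite ?fsetD0.
Qed.

Lemma bvec_pairD1 (q : nat) (L : family q) (l : posnat) :
  l \in cap (val L) ->
  exists M : family q.-1,
    [/\ cap (val M) = cap (val L) `\ l, hat (val M) = hat (val L)
      & bvec_pair q.-1 (cap (val L) `\ l) (hat (val L)) = bvec M].
Proof.
move=> lC; have /andP[L0 /allP Lq] := valP L.
have lL s : s \in val L -> l \in s by move=> sL; apply: (mem_cap _ L0 lC).
pose N : {fset {fset posnat}} := [fset s `\ l | s in val L].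
have NE : of_pair (cap (val L) `\ l) (hat (val L)) = N.
  rewrite of_pairE ?fsubD1set // /N.
  suff -> : cap (val L) `\` (cap (val L) `\ l) = [fset l] by [].
  apply/fsetP => x; rewrite in_fsetD in_fsetD1 in_fset1.
  by case: eqP => [->|_] /=; rewrite ?lC ?andNb.
have N0 : N != fset0.
  by case/fset0Pn: L0 => s sL; apply/fset0Pn; exists (s `\ l); apply: in_imfset.
have Nq : is_family q.-1 N.
  rewrite /is_family N0; apply/allP => _ /imfsetP[s /= sL ->].
  by have := Lq s sL; rewrite (cardfsD1 l) lL // add1n => /eqP <-.
have capN : cap N = cap (val L) `\ l.
  apply/fsetP => x; rewrite in_fsetD1.
  apply/idP/andP => [/(mem_cap _ N0) xN|[xl /(mem_cap _ L0) xL]]; last first.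
    by apply/(mem_cap _ N0) => _ /imfsetP[s /= sL ->]; rewrite in_fsetD1 xl xL.
  have xL s : s \in val L -> (x != l) && (x \in s).
    by move=> sL; rewrite -in_fsetD1; apply: xN; apply/imfsetP; exists s.
  split; last by apply/(mem_cap _ L0) => s /xL/andP[].
  by case/fset0Pn: L0 => s /xL/andP[].
exists (Sub N Nq); rewrite SubK; split=> //; last first.
  by rewrite /bvec_pair NE insubT.
rewrite /hat capN.
have DD s : (s `\ l) `\` (cap (val L) `\ l) = s `\` cap (val L).
  apply/fsetP => x; rewrite !(in_fsetD, in_fset1).
  by case: eqP => [->|_] //=; rewrite lC.
apply/fsetP => s; apply/imfsetP/imfsetP => [[_ /imfsetP[u /= uL ->] ->]|[u /= uL ->]].
  by exists u.
by exists (u `\ l); rewrite ?DD //; apply/imfsetP; exists u.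
Qed.

Lemma delta0 (x : frakA 0) : delta x = 0.
Proof.
rewrite /delta big1 // => L _; rewrite /delta_basis.
have c0 : cap (val L) = fset0.
  have /andP[L0 /allP Lq] := valP L; apply/fsetP => x1.
  rewrite in_fset0; apply/negP => /(mem_cap _ L0) h.
  case/fset0Pn: L0 => s sL; have := h s sL.
  by move: (Lq s sL); rewrite cardfs_eq0 => /eqP ->.
rewrite c0 (perm_big (fset0 : {fset posnat})) ?perm_sort //= big_seq_fset0 scaler0 //.
Qed.

Lemma deltaEw (q : nat) (x : frakA q) (D : {fset family q}) :
  msupp x `<=` D -> delta x = \sum_(L <- D) x@_L *: delta_basis L.
Proof.
move=> sxD; rewrite /delta (big_fset_incl _ sxD) //= => L _ /mcoeff_outdom ->.
by rewrite scale0r.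
Qed.

Lemma delta_is_linear (q : nat) : linear (@delta q).
Proof.
move=> c x y; set D := msupp x `|` msupp y.
rewrite !(@deltaEw q _ D) ?fsubsetUl ?fsubsetUr //; last first.
  apply: fsubset_trans (msuppD_le _ _) _.
  by apply: fsetSU; apply: msuppZ_le.
rewrite scaler_sumr -big_split /=; apply: eq_bigr => L _.
by rewrite mcoeffD mcoeffZ scalerDl scalerA.
Qed.
HB.instance Definition _ (q : nat) :=
  GRing.isLinear.Build rat (frakA q) (frakA q.-1) *:%R (@delta q)
    (@delta_is_linear q).

Lemma delta_bvec (q : nat) (L : family q) : delta (bvec L) = delta_basis L.
Proof.
rewrite /delta /bvec msuppU oner_eq0 big_seq_fset1 mcoeffUU scale1r //.
Qed.

Lemma mem_increasing (C : {fset posnat}) : increasing C =i C.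
Proof. by move=> x; rewrite mem_sort. Qed.

Lemma index_rem (T : eqType) (s : seq T) (l m : T) : l != m ->
  index m (rem l s) = (index m s - (index l s < index m s))%N.
Proof.
move=> lm; elim: s => //= a s IHs.
have [->|al] := eqVneq a l; first by rewrite (negPf lm) subn1.
rewrite /= IHs; case: eqVneq => // _; rewrite ltnS.
by case: ltnP => [/ltn_predK <-|_]; rewrite ?subn0 ?subn1.
Qed.

Lemma increasingD1 (C : {fset posnat}) (l : posnat) :
  increasing (C `\ l) = rem l (increasing C).
Proof.
have leT : total (fun x y : posnat => (val x <= val y)%N).
  by move=> x y; apply: leq_total.
have le_tr : transitive (fun x y : posnat => (val x <= val y)%N).
  by move=> x y z; apply: leq_trans.
have le_anti : antisymmetric (fun x y : posnat => (val x <= val y)%N).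
  by move=> x y xy; apply/val_inj/anti_leq.
rewrite rem_filter ?sort_uniq ?fset_uniq // /increasing filter_sort //.
apply/perm_sortP => //; apply: uniq_perm; rewrite ?filter_uniq ?fset_uniq //.
by move=> x; rewrite in_fsetD1 mem_filter.
Qed.

Lemma sign_swap (C : {fset posnat}) (l m : posnat) :
  l \in C -> m \in C -> l != m ->
  (-1) ^+ position C l * (-1) ^+ position (C `\ l) m =
  - ((-1) ^+ position C m * (-1) ^+ position (C `\ m) l) :> rat.
Proof.
move=> lC mC lm; rewrite /position !increasingD1 !index_rem // 1?eq_sym //.
set i := index l _; set j := index m _.
have ij : i != j.
  apply: contra lm => /eqP/(congr1 (nth l (increasing C))).
  by rewrite !nth_index ?mem_increasing // => ->.
move: i j ij => i j ij; wlog ltij : i j ij / (i < j)%N => [hw|].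
  have := ij; rewrite neq_ltn => /orP[ltij|ltji]; first exact: hw.
  by rewrite -[LHS]opprK -(hw j i) // eq_sym.
rewrite ltij (ltnNge j) ltnW //= subn0; case: j ltij {ij} => // j _.
by rewrite subn1 /= [_ ^+ j.+2]exprS mulN1r mulNr mulrC opprK.
Qed.

Lemma eq_oppr0 (V : lmodType rat) (v : V) : v = - v -> v = 0.
Proof.
move=> vN; have : (2%:R : rat) *: v = 0 by rewrite scaler_nat mulr2n {2}vN subrr.
by move/eqP; rewrite scaler_eq0 => /orP[//|/eqP].
Qed.

Lemma delta_delta (q : nat) (x : frakA q) : delta (delta x) = 0.
Proof.
rewrite {2}/delta linear_sum big1 //= => L _; rewrite linearZ /=.
suff -> : delta (delta_basis L) = 0 by rewrite scaler0.
rewrite /delta_basis; set C := cap (val L); set H := hat (val L).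
pose g l m : frakA q.-2 := ((-1) ^+ position C l * (-1) ^+ position (C `\ l) m)
  *: bvec_pair q.-2 (C `\ l `\ m) H.
pose S := \sum_(l <- C) \sum_(m <- C | m != l) g l m.
transitivity S.
  rewrite linear_sum /= (perm_big C) ?perm_sort //= /S.
  rewrite [LHS]big_seq [RHS]big_seq; apply: eq_bigr => l lC; rewrite linearZ /=.
  have [M [capM hatM ->]] := bvec_pairD1 lC.
  rewrite delta_bvec /delta_basis capM hatM (perm_big (C `\ l)) ?perm_sort //=.
  rewrite scaler_sumr -[RHS]big_filter.
  rewrite (perm_big [seq m <- C | m != l]) /=.
    by apply: eq_bigr => m _; rewrite scalerA.
  apply: uniq_perm; rewrite ?filter_uniq ?fset_uniq // => m.
  by rewrite in_fsetD1 mem_filter.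
suff : S = - S by apply: eq_oppr0.
rewrite {2}/S (exchange_big_dep predT) //= /S -sumrN.
rewrite [LHS]big_seq [RHS]big_seq; apply: eq_bigr => l lC.
rewrite -sumrN [LHS]big_seq_cond [RHS]big_seq_cond.
apply: eq_big => m; first by rewrite eq_sym.
case/andP => mC ml; rewrite /g sign_swap 1?eq_sym // scaleNr.
by have -> : C `\ l `\ m = C `\ m `\ l by rewrite !fsetDDl fsetUC.
Qed.

Definition cycles (q : nat) : {pred frakA q} := fun x => delta x == 0.

Lemma cyclesP (q : nat) (x : frakA q) :
  reflect (delta x = 0) (x \in @cycles q).
Proof. exact: eqP. Qed.

Lemma cycles_submod_closed (q : nat) : submod_closed (@cycles q).
Proof.
split=> [|c x y /cyclesP x0 /cyclesP y0]; apply/cyclesP; first exact: linear0.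
by rewrite (delta_is_linear c x y) x0 y0 scaler0 addr0.
Qed.
HB.instance Definition _ (q : nat) :=
  GRing.isSubmodClosed.Build rat (frakA q) (@cycles q)
    (@cycles_submod_closed q).

Definition cycle_space (q : nat) := {x : frakA q | x \in @cycles q}.
HB.instance Definition _ (q : nat) := SubChoice.on (cycle_space q).
HB.instance Definition _ (q : nat) :=
  [SubChoice_isSubLmodule of cycle_space q by <:].

(* By delta_delta these are the images of all elements of degree q.+1. *)
Definition boundaries (q : nat) : {pred cycle_space q} :=
  fun z => `[< exists y : frakA q.+1, delta y = val z >].

Lemma boundaries_zmod_closed (q : nat) : zmod_closed (@boundaries q).
Proof.
split=> [|u v /asboolP[x xu] /asboolP[y yv]]; apply/asboolP.
  by exists 0; rewrite linear0 raddf0.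
by exists (x - y); rewrite linearB /= xu yv.
Qed.
HB.instance Definition _ (q : nat) :=
  GRing.isZmodClosed.Build (cycle_space q) (@boundaries q)
    (@boundaries_zmod_closed q).

(* ker delta / im delta in degree q *)
Definition homology (q : nat) : zmodType := Quotient.quot (@boundaries q).

(* Main.v *)
(* For a fixed second component H, the families (C, H) index the augmented
   simplicial chain complex of a simplex on infinitely many vertices, which is
   contracted by coning: if m exceeds every integer occurring in x, adding m
   to each member of each family, with sign (-1)^(#|C| + 1), gives a map s
   with delta (s x) + s (delta x) = x. No single m serves every x, but a cycle
   has finite support, so it bounds its own cone. *)
From HB Require Import structures.
From mathcomp Require Import all_boot all_algebra.
From mathcomp Require Import finmap boolp monalg.
Require Import Defs.

Set Implicit Arguments.
Unset Strict Implicit.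
Unset Printing Implicit Defensive.

Import GRing.Theory.
Local Open Scope fset_scope.
Local Open Scope ring_scope.

Lemma increasingU1 (C : {fset posnat}) (m : posnat) :
  (forall l, l \in C -> (val l < val m)%N) ->
  increasing (m |` C) = rcons (increasing C) m.
Proof.
move=> Cm.
have leT : total (fun x y : posnat => (val x <= val y)%N).
  by move=> x y; apply: leq_total.
have le_tr : transitive (fun x y : posnat => (val x <= val y)%N).
  by move=> x y z; apply: leq_trans.
have le_anti : antisymmetric (fun x y : posnat => (val x <= val y)%N).
  by move=> x y xy; apply/val_inj/anti_leq.
apply: (sorted_eq le_tr le_anti); first exact: sort_sorted.
- rewrite sorted_pairwise // pairwise_rcons -sorted_pairwise // sort_sorted //.
  by rewrite andbT; apply/allP => l; rewrite mem_increasing => /Cm/ltnW.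
- have mC : m \notin C by apply/negP => /Cm; rewrite ltnn.
  rewrite perm_sort; apply: uniq_perm; rewrite ?fset_uniq //.
    by rewrite rcons_uniq mem_increasing mC sort_uniq fset_uniq.
  by move=> x; rewrite mem_rcons !inE mem_increasing.
Qed.

Lemma size_increasing (C : {fset posnat}) : size (increasing C) = #|` C|.
Proof. exact: size_sort. Qed.

(** Since [m] lies in no member of [L], adding it to all of them enlarges the intersection by
    exactly [m] and leaves the differences with the intersection alone. Under this hypothesis the
    coned vector is thus a genuine basis vector, not the default 0 of [bvec_pair]. *)
Lemma bvec_pairU1 (q : nat) (L : family q) (m : posnat) :
  (forall s, s \in val L -> m \notin s) ->
  exists M : family q.+1,
    [/\ cap (val M) = m |` cap (val L), hat (val M) = hat (val L)
      & bvec_pair q.+1 (m |` cap (val L)) (hat (val L)) = bvec M].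
Proof.
move=> mL; have /andP[L0 /allP Lq] := valP L.
pose N : {fset {fset posnat}} := [fset m |` s | s in val L].
have N0 : N != fset0.
  by case/fset0Pn: L0 => s sL; apply/fset0Pn; exists (m |` s); apply: in_imfset.
have Nq : is_family q.+1 N.
  rewrite /is_family N0; apply/allP => _ /imfsetP[s /= sL ->].
  by rewrite cardfsU1 mL // (eqP (Lq s sL)).
have capN : cap N = m |` cap (val L).
  apply/fsetP => x; rewrite in_fset1U.
  apply/(mem_cap _ N0)/idP => [xN|].
    case: (eqVneq x m) => //= xm; apply/(mem_cap _ L0) => s sL.
    have /xN : m |` s \in N by apply: in_imfset.
    by rewrite in_fset1U (negPf xm).
  move=> xC _ /imfsetP[s /= sL ->]; rewrite in_fset1U.
  by case/predU1P: xC => [->|/(mem_cap _ L0)/(_ s sL) ->]; rewrite ?eqxx ?orbT.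
have hatN : hat N = hat (val L).
  have DU s : s \in val L -> (m |` s) `\` cap N = s `\` cap (val L).
    move=> sL; apply/fsetP => x; rewrite capN !(in_fsetD, in_fset1U).
    by case: eqP => [->|_] //=; rewrite (negPf (mL s sL)) andbF.
  apply/fsetP => s; apply/imfsetP/imfsetP
    => [[_ /imfsetP[u /= uL ->] ->]|[u /= uL ->]].
    by exists u; rewrite ?DU.
  by exists (m |` u); rewrite ?DU //; apply: in_imfset.
exists (Sub N Nq); split; rewrite ?SubK //.
by rewrite -bvec_pairE SubK capN hatN.
Qed.

(* The degree p of the target is q.+1 on frakA q and q on frakA q.-1; it is a
   free parameter because q.-1.+1 is not q when q = 0. *)
Definition cone_basis (m : posnat) (p : nat) (q : nat) (L : family q) :
    frakA p :=
  (-1) ^+ #|` cap (val L)|.+1 *: bvec_pair p (m |` cap (val L)) (hat (val L)).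

Definition cone (m : posnat) (p : nat) (q : nat) (x : frakA q) : frakA p :=
  \sum_(L <- msupp x) x@_L *: cone_basis m p L.

Lemma coneEw (m : posnat) (p q : nat) (x : frakA q) (D : {fset family q}) :
  msupp x `<=` D -> cone m p x = \sum_(L <- D) x@_L *: cone_basis m p L.
Proof.
move=> sxD; rewrite /cone (big_fset_incl _ sxD) //= => L _ /mcoeff_outdom ->.
by rewrite scale0r.
Qed.

Lemma cone_is_linear (m : posnat) (p q : nat) : linear (@cone m p q).
Proof.
move=> c x y; set D := msupp x `|` msupp y.
rewrite !(@coneEw m p q _ D) ?fsubsetUl ?fsubsetUr //; last first.
  apply: fsubset_trans (msuppD_le _ _) _.
  by apply: fsetSU; apply: msuppZ_le.
rewrite scaler_sumr -big_split /=; apply: eq_bigr => L _.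
by rewrite mcoeffD mcoeffZ; move: (cone_basis _ _ _) => v;
   rewrite scalerDl scalerA.
Qed.
HB.instance Definition _ (m : posnat) (p q : nat) :=
  GRing.isLinear.Build rat (frakA q) (frakA p) *:%R (@cone m p q)
    (@cone_is_linear m p q).

Lemma cone_bvec (m : posnat) (p q : nat) (L : family q) :
  cone m p (bvec L) = cone_basis m p L.
Proof.
by rewrite /cone /bvec msuppU oner_eq0 big_seq_fset1 mcoeffUU scale1r.
Qed.

Lemma malgUE (K : choiceType) (R : nzRingType) (c : R) (k : K) :
  << c *g k >> = c *: (<< k >> : {malg R[K]}).
Proof. by apply/malgP => k'; rewrite mcoeffZ !mcoeffU mulr_natr. Qed.

Lemma frakA_sum (q : nat) (x : frakA q) :
  x = \sum_(L <- msupp x) x@_L *: bvec L.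
Proof.
by rewrite {1}[x]monalgE; apply: eq_bigr => L _; rewrite malgUE.
Qed.

(** Deleting [m] from the cone gives back [L]; deleting some [l] in [C] gives the cone over the face
    of [L] without [l]. The latter terms cancel against [cone m q (delta (bvec L))], because the
    cone sign changes when [C] loses an element. *)
Lemma delta_cone_bvec (q : nat) (L : family q) (m : posnat) :
  (forall s, s \in val L -> forall l, l \in s -> (val l < val m)%N) ->
  delta (cone m q.+1 (bvec L)) + cone m q (delta (bvec L)) = bvec L.
Proof.
move=> Lm; set C := cap (val L); set H := hat (val L).
have mL s : s \in val L -> m \notin s.
  by move=> sL; apply/negP => /(Lm s sL); rewrite ltnn.
have Cm l : l \in C -> (val l < val m)%N.
  have /andP[L0 _] := valP L; case/fset0Pn: (L0) => s sL.
  by move=> /(mem_cap _ L0)/(_ s sL)/(Lm s sL).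
have mC : m \notin C by apply/negP => /Cm; rewrite ltnn.
have [M [capM hatM bM]] := bvec_pairU1 mL.
rewrite cone_bvec /cone_basis bM linearZ /= !delta_bvec /delta_basis capM hatM.
rewrite -/C -/H increasingU1 // -cats1 big_cat big_seq1 /= scalerDr addrAC.
rewrite fsetU1K // bvec_pairE scalerA /position increasingU1 //.
rewrite -cats1 index_cat mem_increasing (negPf mC) /= eqxx addn0 size_increasing.
rewrite -[_ * _]expr2 sqrr_sign scale1r.
(* The other summands are matched for each [l] in [C] and cancel in pairs. *)
rewrite scaler_sumr linear_sum -big_split /= big_seq big1 ?add0r // => l.
rewrite mem_increasing => lC; have lm : l != m by apply: contraNneq mC => <-.
have [M' [capM' hatM' bM']] := bvec_pairD1 lC.
rewrite bM' [cone m q _]linearZ /= cone_bvec /cone_basis capM' hatM' -/C -/H.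
(* The position of [l] is the same in [C] and in its cone, while the cone signs have exponents [#|]
   C|.+1[and]#|[C|], hence are opposite. *)
rewrite index_cat mem_increasing lC (cardfsD1 l C) lC add1n.
have -> : (m |` C) `\ l = m |` (C `\ l).
  apply/fsetP => x; rewrite !inE.
  by case: (eqVneq x l) => // ->; rewrite (negPf lm).
rewrite !scalerA -scalerDl [_ ^+ (_.+2)]exprS mulN1r mulNr mulrC.
by rewrite addNr scale0r.
Qed.

Lemma delta_cone (q : nat) (x : frakA q) (m : posnat) :
  (forall L, L \in msupp x -> forall s, s \in val L ->
     forall l, l \in s -> (val l < val m)%N) ->
  delta (cone m q.+1 x) + cone m q (delta x) = x.
Proof.
move=> xm; rewrite [in RHS](frakA_sum x) [in LHS](frakA_sum x).
rewrite (linear_sum (@cone m q.+1 q)) !(linear_sum (@delta _)).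
rewrite (linear_sum (@cone m q q.-1)) -big_split big_seq [RHS]big_seq /=.
apply: eq_bigr => L /xm Lm; rewrite (linearZ _ (bvec L)).
rewrite (linearZ _ (cone m _ _)) (linearZ _ (bvec L)) (linearZ _ (delta _)) /=.
by rewrite -scalerDr delta_cone_bvec.
Qed.

Lemma frakA_bounded (q : nat) (x : frakA q) :
  exists m : posnat, forall L, L \in msupp x -> forall s, s \in val L ->
    forall l, l \in s -> (val l < val m)%N.
Proof.
pose n := \max_(L <- msupp x) \max_(s <- val L) \max_(l <- s) val l.
(* The successor makes the bound strict and also positive, as [posnat] demands. *)
exists (exist _ n.+1 (ltn0Sn n)) => L Lx s sL l ls; rewrite ltnS.
apply: leq_trans (leq_bigmax_seq _ Lx isT).
apply: leq_trans (leq_bigmax_seq _ sL isT).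
exact: (leq_bigmax_seq l ls isT).
Qed.

Theorem corollary5p6 : forall (q : nat) (h : homology q), h = 0.
Proof.
move=> q h; rewrite -[h]reprK -[RHS]pi_zeror.
(* Vanishing in the quotient becomes membership of the representative in [boundaries]. *)
apply/eqP; rewrite -Quotient.idealrBE subr0; apply/asboolP.
set z := repr h; have [m zm] := frakA_bounded (val z).
exists (cone m q.+1 (val z)).
(* For a cycle the second term of the homotopy identity is the cone of 0. *)
rewrite -[RHS](delta_cone zm) (cyclesP _ (valP z)).
by rewrite linear0 addr0.
Qed.
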